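(* Let $\Gamma$ be an abelian group. Set $G=\mathbb{Z}\wr\Gamma$ and $N=\bigoplus_\Gamma\mathbb{Z}$. Then $$\{(\mathrm{cl}_G(x),\mathrm{cl}_{G,N}(x))\mid x\in[G,N]\}=\left\{\left(\left\lceil\frac r2\right\rceil,r\right)\;\middle|\;r\in\mathbb{Z}_{\ge0},\ r\le\mathrm{spe}\text{-}\mathrm{rk}(\Gamma)\right\},$$ where $\lceil\cdot\rceil$ is the ceiling function. In particular, if $\Gamma$ is not locally cyclic, then for the pair $(G,N)=(\mathbb{Z}\wr\Gamma,\bigoplus_\Gamma\mathbb{Z})$, which fits in the split exact sequence $1\to N\to G\to\Gamma\to1$, the functions $\mathrm{cl}_G$ and $\mathrm{cl}_{G,N}$ do not coincide on $[G,N]$. If moreover $\mathrm{spe}\text{-}\mathrm{rk}(\Gamma)=\infty$, then for the same pair $(G,N)$, $$\sup_{x\in[G,N]}\left(\mathrm{cl}_{G,N}(x)-C\cdot\mathrm{cl}_G(x)\right)=\infty$$ for every real number $C<2$.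
   Context: For groups $H,\Gamma$, the (restricted) wreath product is $H\wr\Gamma=\left(\bigoplus_\Gamma H\right)\rtimes\Gamma$, where $\Gamma$ acts by shifting coordinates: $(\lambda u)(\gamma)=u(\lambda^{-1}\gamma)$. For a group $G$ and a normal subgroup $N$, a mixed commutator is an element $[g,x]=gxg^{-1}x^{-1}$ with $g\in G$, $x\in N$; $[G,N]$ is the subgroup generated by mixed commutators, and for $x\in[G,N]$, $\mathrm{cl}_{G,N}(x)$ is the smallest integer $n\ge0$ such that $x$ is a product of $n$ mixed commutators. $\mathrm{cl}_G=\mathrm{cl}_{G,G}$ is the ordinary commutator length on $[G,G]$. A group is locally cyclic if every finitely generated subgroup is cyclic. The rank of a group $\Lambda$ is $\mathrm{rk}(\Lambda)=\inf\{\#S\mid\Lambda=\langle S\rangle\}$. The special rank of $\Gamma$ is $\mathrm{spe}\text{-}\mathrm{rk}(\Gamma)=\sup\{\mathrm{rk}(\Lambda)\mid\Lambda\text{ is a finitely generated subgroup of }\Gamma\}\in\mathbb{Z}_{\ge0}\cup\{\infty\}$. *)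

(* Defs.v *)
From HB Require Import structures.
From mathcomp Require Import all_boot all_order all_algebra finmap.
From mathcomp Require Import all_classical all_reals ereal.

Set Implicit Arguments.
Unset Strict Implicit.
Unset Printing Implicit Defensive.

Import Order.TTheory GRing.Theory Num.Theory.

Local Open Scope classical_set_scope.
Local Open Scope group_scope.

Definition dsum (K : choiceType) (H : groupType) := {fsfun K -> H with 1}.

HB.instance Definition _ K H := Choice.on (dsum K H).

Section DirectSum.
Variables (K : choiceType) (H : groupType).
Implicit Types u v w : dsum K H.

Definition dsum_one : dsum K H := [fsfun with 1].

Definition dsum_mul u v : dsum K H :=
  [fsfun k in (finsupp u `|` finsupp v)%fset => u k * v k | 1].

Definition dsum_inv u : dsum K H := [fsfun k in finsupp u => (u k)^-1 | 1].

Lemma dsum_oneE k : dsum_one k = 1.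
Proof. exact: fsfun0E. Qed.

Lemma dsum_mulE u v k : dsum_mul u v k = u k * v k.
Proof.
rewrite fsfunE in_fsetU; case: ifPn => // /norP[uk vk].
by rewrite !fsfun_dflt // mulg1.
Qed.

Lemma dsum_invE u k : dsum_inv u k = (u k)^-1.
Proof. by rewrite fsfunE; case: ifPn => // uk; rewrite fsfun_dflt // invg1. Qed.

Fact dsum_mulA : associative dsum_mul.
Proof. by move=> u v w; apply/fsfunP => k; rewrite !dsum_mulE mulgA. Qed.

Fact dsum_mul1 : left_id dsum_one dsum_mul.
Proof. by move=> u; apply/fsfunP => k; rewrite dsum_mulE dsum_oneE mul1g. Qed.

Fact dsum_mulr1 : right_id dsum_one dsum_mul.
Proof. by move=> u; apply/fsfunP => k; rewrite dsum_mulE dsum_oneE mulg1. Qed.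

Fact dsum_mulV : left_inverse dsum_one dsum_inv dsum_mul.
Proof.
by move=> u; apply/fsfunP => k; rewrite dsum_mulE dsum_invE dsum_oneE mulVg.
Qed.

Fact dsum_mulrV : right_inverse dsum_one dsum_inv dsum_mul.
Proof.
by move=> u; apply/fsfunP => k; rewrite dsum_mulE dsum_invE dsum_oneE mulgV.
Qed.

HB.instance Definition _ := isGroup.Build (dsum K H)
  dsum_mulA dsum_mul1 dsum_mulr1 dsum_mulV dsum_mulrV.

Lemma dsum1E k : (1 : dsum K H) k = 1.
Proof. exact: dsum_oneE. Qed.

Lemma dsumME u v k : (u * v : dsum K H) k = u k * v k.
Proof. exact: dsum_mulE. Qed.

Lemma dsumVE u k : (u^-1 : dsum K H) k = (u k)^-1.
Proof. exact: dsum_invE. Qed.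

End DirectSum.

Section Shift.
Variables (Gamma H : groupType).
Implicit Types (a b : Gamma) (u v : dsum Gamma H).

Definition shift a u : dsum Gamma H :=
  [fsfun g in [fset a * k | k in finsupp u]%fset => u (a^-1 * g) | 1].

Lemma shiftE a u g : shift a u g = u (a^-1 * g).
Proof.
rewrite fsfunE; case: ifPn => // gNu; rewrite fsfun_dflt //.
apply: contra gNu => ku; apply/imfsetP; exists (a^-1 * g) => //.
by rewrite mulgA mulgV mul1g.
Qed.

Lemma shift1 u : shift 1 u = u.
Proof. by apply/fsfunP => g; rewrite shiftE invg1 mul1g. Qed.

Lemma shiftM a b u : shift (a * b) u = shift a (shift b u).
Proof. by apply/fsfunP => g; rewrite !shiftE invgM mulgA. Qed.

Lemma shift_mul a u v : shift a (u * v) = shift a u * shift a v.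
Proof. by apply/fsfunP => g; rewrite !(shiftE, dsumME). Qed.

Lemma shift_one a : shift a 1 = 1.
Proof. by apply/fsfunP => g; rewrite shiftE !dsum1E. Qed.

End Shift.

(* The restricted wreath product of H by Gamma; [Wreath u a] is the element
   u a of the semidirect product, with a u a^-1 = shift a u. *)
Record wreath (H Gamma : groupType) := Wreath
  { wbase : dsum Gamma H; wtop : Gamma }.

Section WreathProduct.
Variables (H Gamma : groupType).
Local Notation G := (wreath H Gamma).
Implicit Types x y z : G.

Definition wreath_pair x : dsum Gamma H * Gamma := (wbase x, wtop x).
Definition pair_wreath (p : dsum Gamma H * Gamma) : G := Wreath p.1 p.2.

Fact wreath_pairK : cancel wreath_pair pair_wreath.
Proof. by case. Qed.

HB.instance Definition _ := Choice.copy G (can_type wreath_pairK).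

Definition wreath_one : G := Wreath 1 1.

Definition wreath_mul x y : G :=
  Wreath (wbase x * shift (wtop x) (wbase y)) (wtop x * wtop y).

Definition wreath_inv x : G :=
  Wreath (shift (wtop x)^-1 (wbase x)^-1) (wtop x)^-1.

Fact wreath_mulA : associative wreath_mul.
Proof.
move=> [u a] [v b] [w c]; congr Wreath => /=; last by rewrite mulgA.
by rewrite shift_mul -shiftM mulgA.
Qed.

Fact wreath_mul1 : left_id wreath_one wreath_mul.
Proof. by case=> u a; rewrite /wreath_mul /= shift1 !mul1g. Qed.

Fact wreath_mulr1 : right_id wreath_one wreath_mul.
Proof. by case=> u a; rewrite /wreath_mul /= shift_one !mulg1. Qed.

Fact wreath_mulV : left_inverse wreath_one wreath_inv wreath_mul.
Proof.
by case=> u a; rewrite /wreath_mul /= -shift_mul !mulVg shift_one.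
Qed.

Fact wreath_mulrV : right_inverse wreath_one wreath_inv wreath_mul.
Proof. by case=> u a; rewrite /wreath_mul /= -shiftM !mulgV shift1 mulgV. Qed.

HB.instance Definition _ := isGroup.Build G
  wreath_mulA wreath_mul1 wreath_mulr1 wreath_mulV wreath_mulrV.

Definition base_inj (u : dsum Gamma H) : G := Wreath u 1.

Definition base_group : set G := range base_inj.

End WreathProduct.

Arguments base_group : clear implicits.

Section GroupNotions.
Variable G : groupType.
Implicit Types (N K : set G) (x g : G) (S : {fset G}).

Definition generated (A : set G) : set G :=
  smallest [set K | group_closed [in K]] A.

(* MathComp's [~ x, y] is x^-1 y^-1 x y; the convention here is
   [g, x] = g x g^-1 x^-1. *)
Definition commutator g x : G := g * x * g^-1 * x^-1.

Definition mixed_commutators N : set G :=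
  [set commutator g x | g in [set: G] & x in N].

Definition mixed_commutator_subgroup N : set G :=
  generated (mixed_commutators N).

Definition mixed_commutator_product N n x : Prop :=
  exists2 c : 'I_n -> G,
    (forall i, mixed_commutators N (c i)) & x = \prod_(i < n) c i.

(* cl_{G,N} x.  For N normal, the inverse of a mixed commutator is again one,
   so that the set below is inhabited for x in [G, N]; the default value 0 is
   only reached outside [G, N]. *)
Definition cl N x : nat :=
  xget 0 [set n | mixed_commutator_product N n x /\
                  forall m, mixed_commutator_product N m x -> (n <= m)%N].

Definition fin_gen K : Prop := exists S, K = generated [set` S].

Definition locally_cyclic : Prop :=
  forall K, fin_gen K -> exists g, K = generated [set g].

(* An infimum over the empty set is +oo, so only finite generating sets have
   to be considered. *)
Definition rk (R : realType) K : \bar R :=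
  ereal_inf [set (#|` S|%:R)%:E | S in [set S | K = generated [set` S]]].

Definition spe_rk (R : realType) : \bar R :=
  ereal_sup [set rk R K | K in fin_gen].

End GroupNotions.

Definition split_exact (G Q : groupType) (N : set G) (p : G -> Q) : Prop :=
  [/\ monoid.monoid_morphism p, p @^-1` [set 1] = N
    & exists2 s : Q -> G, monoid.monoid_morphism s & cancel s p].

(* Main.v *)
Require Import Defs.
From mathcomp Require Import all_boot all_order all_algebra finmap.
From mathcomp Require Import all_classical all_reals ereal.
From mathcomp Require Import lra.

(* Write N additively as the group ring Z[Gamma]. A mixed commutator of (G, N)
   is (a - 1) v with a in Gamma and v in Z[Gamma], and since Gamma is abelian a
   commutator of G is (a - 1) v + (b - 1) u. Hence a product of n commutators of
   G is the same thing as a product of 2n mixed commutators, and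
   cl_G = ceil (cl_{G,N} / 2) on [G, N]. Moreover cl_{G,N} x <= n if and only if
   x lies in the ideal generated by the a - 1 for a in some subgroup of Gamma
   generated by n elements, so cl_{G,N} is bounded by the special rank. If
   a_1, ..., a_r generate a subgroup of rank r, then the sum of the a_i - 1 has
   cl_{G,N} equal to r: if it lies in the ideal attached to a subgroup M, then
   its coefficients over M sum to 0, which forces every a_i into M; and in an
   abelian group the rank is monotone on subgroups. *)

Set Implicit Arguments.
Unset Strict Implicit.
Unset Printing Implicit Defensive.

Import Order.TTheory GRing.Theory Num.Theory.

Local Open Scope classical_set_scope.

(** * Generating sequences and the rank of subgroups *)

Section GeneratedSubgroups.
Local Open Scope group_scope.
Variable G : groupType.
Implicit Types (A K : set G) (s t : seq G) (a x y : G).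

Definition subgroup K :=
  [/\ K 1, forall x y, K x -> K y -> K (x * y) & forall x, K x -> K x^-1].

Lemma group_closedP K : group_closed [in K] <-> subgroup K.
Proof.
split=> [[K1 KV] | [K1 KM KV]].
  move: K1; rewrite inE => K1.
  have KdV x y : K x -> K y -> K (x / y).
    by move=> Kx Ky; have := KV x y; rewrite !inE; apply.
  have KV1 x : K x -> K x^-1 by move=> /(KdV 1 x K1); rewrite mul1g.
  by split=> // x y Kx /KV1 /(KdV x _ Kx); rewrite invgK.
split; first by rewrite inE.
by move=> x y; rewrite !inE => Kx Ky; apply/KM/KV.
Qed.

Lemma generated_group A : subgroup (generated A).
Proof.
apply/group_closedP; split=> [|x y].
  by rewrite inE => K [[]]; rewrite inE.
rewrite !inE => gx gy K [Kgrp AK]; case: (Kgrp) => _ /(_ x y).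
by rewrite !inE; apply; [apply: gx | apply: gy].
Qed.

Lemma mem_generated A : A `<=` generated A.
Proof. exact: sub_gen_smallest. Qed.

Lemma generated_sub A K : subgroup K -> A `<=` K -> generated A `<=` K.
Proof. by move=> /group_closedP; apply: smallest_sub. Qed.

Lemma eq_generated s t :
    [set` s] `<=` generated [set` t] -> [set` t] `<=` generated [set` s] ->
  generated [set` s] = generated [set` t].
Proof.
move=> st ts; apply/seteqP.
by split; apply: generated_sub => //; apply: generated_group.
Qed.

Lemma fin_genP K : fin_gen K <-> exists s, K = generated [set` s].
Proof.
split=> [[S ->] | [s ->]]; first by exists S.
exists [fset x in s]%fset; congr generated.
by apply/seteqP; split=> x /=; rewrite inE.
Qed.

(** Not linear independence: torsion elements are allowed. In an abelian group it amounts to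
    [size s] being the rank of the subgroup generated by [s]. Containment is used instead of
    equality because this is what membership in an augmentation ideal yields. *)
Definition independent s := forall t,
  [set` s] `<=` generated [set` t] -> (size s <= size t)%N.

Lemma generated_take n s : generated [set` take n s] `<=` generated [set` s].
Proof.
apply: generated_sub => [|x /= /mem_take sx]; first exact: generated_group.
exact: mem_generated.
Qed.

Hypothesis cG : forall x y, commute x y.

(** Exponents are natural numbers, so negative powers of [a] are reached through [x^-1]. *)
Lemma generated_cons a s x : generated [set` a :: s] x ->
  exists n, exists2 h, generated [set` s] h &
    x = a ^+ n * h \/ x^-1 = a ^+ n * h.
Proof.
set H := generated [set` s]; have [H1 HM HV] := generated_group [set` s].
pose K := [set x | exists n, exists2 h, H h &
  x = a ^+ n * h \/ x^-1 = a ^+ n * h].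
have KV y : K y -> K y^-1.
  by case=> n [h Hh e]; exists n, h => //; rewrite invgK; case: e; [right|left].
have KMp n h m h' : H h -> H h' -> K (a ^+ n * h * (a ^+ m * h')).
  move=> Hh Hh'; exists (n + m)%N, (h * h'); first exact: HM.
  by left; rewrite expgnDr -!mulgA; congr (_ * _); rewrite !mulgA (cG h).
have KMn n h m h' : H h -> H h' -> K (a ^+ n * h * (a ^+ m * h')^-1).
  (* Inversion exchanges the two exponents, and [K] is stable under it. *)
  wlog le_mn : n h m h' / (m <= n)%N => [wl Hh Hh'|].
    have [/wl|/ltnW/wl wl'] := leqP m n; first exact.
    by rewrite -[X in K X]invgK; apply/KV; rewrite invgM invgK; apply: wl'.
  move=> Hh Hh'; exists (n - m)%N, (h * h'^-1).
    by apply: HM => //; apply: HV.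
  left; rewrite -{1}(subnK le_mn) expgnDr invgM -!mulgA; congr (_ * _).
  by rewrite (cG h'^-1) !mulgA (cG _ h) -!mulgA mulVKg.
apply: (@generated_sub _ K) => [|y /=]; first split=> //.
- by exists 0%N, 1 => //; left; rewrite mulg1.
- move=> y z [n [h Hh ey]] [m [h' Hh' ez]].
  case: ey ez => [->|/(canRL invgK)->] [->|/(canRL invgK)->].
  + exact: KMp.
  + exact: KMn.
  + by rewrite cG; apply: KMn.
  + by rewrite -invgM; apply: KV; apply: KMp.
rewrite inE => /predU1P[->|ys].
  by exists 1%N, 1 => //; left; rewrite expg1 mulg1.
by exists 0%N, y; [exact: mem_generated | left; rewrite mul1g].
Qed.

(** Monotonicity of the rank, by induction on [s]: the induction hypothesis covers the part of [K]
    inside the subgroup generated by the tail, and at most one more generator accounts for the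
    powers of [a]. *)
Lemma subgroup_generated s K : subgroup K -> K `<=` generated [set` s] ->
  exists2 t, (size t <= size s)%N & K = generated [set` t].
Proof.
elim: s K => [|a s IHs] K Kgrp Ks.
  exists [::] => //; apply/seteqP; split=> //.
  exact: generated_sub.
set H := generated [set` s]; have Hgrp := generated_group [set` s].
have [K1 KM KV] := Kgrp; have [H1 HM HV] := Hgrp.
have KHgrp : subgroup (K `&` H).
  split=> [//|x y [Kx Hx] [Ky Hy]|x [Kx Hx]].
    by split; [apply: KM | apply: HM].
  by split; [apply: KV | apply: HV].
have [t tS defKH] := IHs _ KHgrp (@subIsetr _ _ _).
(* The least positive exponent d of a among the elements a^n h of K, h in H,
   is attained at some g; by Euclidean division, g and K `&` H generate K. *)
pose D n := (0 < n)%N /\ exists2 h, H h & K (a ^+ n * h).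
have [[n0 /asboolP Dn0]|noD] := pselect (exists n, `[< D n >]).
  have ex_D : exists n, `[< D n >] by exists n0; apply/asboolP.
  have [d /asboolP[d_gt0 [h0 Hh0 Kd]] d_min] := ex_minnP ex_D.
  exists (a ^+ d * h0 :: t); first by rewrite ltnS.
  set g := a ^+ d * h0 in Kd *.
  have [T1 TM TV] := generated_group [set` g :: t].
  have Tg : generated [set` g :: t] g.
    by apply: mem_generated; rewrite /= mem_head.
  have tT : generated [set` t] `<=` generated [set` g :: t].
    apply: generated_sub => [|x /= xt]; first by split.
    by apply: mem_generated; rewrite /= inE xt orbT.
  have powT n x : generated [set` g :: t] x -> generated [set` g :: t] (x ^+ n).
    by move=> Tx; elim: n => [|n IHn] //; rewrite expgS; apply: TM.
  have powK n : K (g ^+ n).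
    by elim: n => [|n IHn] //; rewrite expgS; apply: KM.
  have powH n x : H x -> H (x ^+ n).
    by move=> Hx; elim: n => [|n IHn] //; rewrite expgS; apply: HM.
  apply/seteqP; split; last first.
    apply: generated_sub => // x /=; rewrite inE => /predU1P[-> //|xt].
    suff [] : (K `&` H) x by [].
    by rewrite defKH; apply: mem_generated.
  suff main n h : H h -> K (a ^+ n * h) -> generated [set` g :: t] (a ^+ n * h).
    move=> x Kx; have [n [h Hh [ex|ex]]] := generated_cons (Ks _ Kx).
      by rewrite ex in Kx *; apply: main.
    rewrite -[x]invgK; apply: TV.
    by move/KV: Kx; rewrite ex; apply: main.
  move=> Hh Kx; set x := a ^+ n * h.
  pose q := (n %/ d)%N; pose r := (n %% d)%N.
  have ex : x * (g ^+ q)^-1 = a ^+ r * (h * (h0 ^+ q)^-1).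
    rewrite /x /g expgMn; last exact: cG.
    rewrite -expgnA {1}(divn_eq n d) mulnC -/q -/r [(d * q + r)%N]addnC expgnDr.
    rewrite invgM -!mulgA; congr (_ * _).
    rewrite [(h0 ^+ q)^-1 * _]cG !mulgA; congr (_ * _).
    by rewrite (cG _ h) -!mulgA mulgV mulg1.
  have Hy : H (h * (h0 ^+ q)^-1) by exact: HM _ _ Hh (HV _ (powH _ _ Hh0)).
  have Ky : K (x * (g ^+ q)^-1) by exact: KM _ _ Kx (KV _ (powK _)).
  have r0 : r = 0%N.
    apply/eqP; rewrite -leqn0 leqNgt; apply/negP => r_gt0.
    have /d_min : `[< D r >].
      apply/asboolP; split=> //.
      by exists (h * (h0 ^+ q)^-1) => //; rewrite -ex.
    by rewrite leqNgt ltn_mod d_gt0.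
  have : generated [set` t] (x * (g ^+ q)^-1).
    by rewrite -defKH; split=> //; rewrite ex r0 expg0 mul1g.
  by move=> /tT Tx; rewrite -[x](divgK (g ^+ q)); apply: TM => //; apply: powT.
(* No [a ^+ n * h] with [n] positive and [h] in [H] lies in [K], so no generator has to be added. *)
have KH : K `<=` H.
  have noK n h : H h -> K (a ^+ n * h) -> n = 0%N.
    move=> Hh Kx; apply/eqP; rewrite -leqn0 leqNgt; apply/negP => n_gt0.
    by apply: noD; exists n; apply/asboolP; split=> //; exists h.
  move=> x Kx; have [n [h Hh [ex|ex]]] := generated_cons (Ks _ Kx).
    by move: Kx; rewrite ex => /(noK _ _ Hh) n0; rewrite n0 mul1g.
  move/KV: Kx; rewrite ex => Kx; rewrite -[x]invgK ex; apply: HV.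
  by move: Kx => /(noK _ _ Hh) n0; rewrite n0 mul1g.
by exists t; [exact: leqW | rewrite -defKH; apply/esym/setIidPl].
Qed.

End GeneratedSubgroups.

(** * Augmentation ideals of the group ring Z[Gamma] *)

Section AugmentationIdeals.
Local Open Scope group_scope.
Local Notation Z := (Algebra.to_multiplicative int).
Variable Gamma : groupType.
Local Notation ZG := (dsum Gamma Z).
Implicit Types (u v w : ZG) (a b : Gamma) (s t : seq Gamma) (K : set Gamma).

Lemma dsumC u v : u * v = v * u.
Proof. by apply/fsfunP => k; rewrite !dsumME; apply: addrC. Qed.

Lemma dsumACA u v w x : (u * v) * (w * x) = (u * w) * (v * x).
Proof. by apply/fsfunP => k; rewrite !dsumME; apply: addrACA. Qed.

(** Multiplication by a - 1 in Z[Gamma], whose addition is the group law of [ZG]. *)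
Definition shift_diff a u : ZG := shift a u * u^-1.

Lemma shift_diff_mul a u v :
  shift_diff a (u * v) = shift_diff a u * shift_diff a v.
Proof.
by rewrite /shift_diff shift_mul invgM (dsumC v^-1) dsumACA.
Qed.

Lemma shift_diff_one a : shift_diff a 1 = 1.
Proof. by rewrite /shift_diff shift_one invg1 mulg1. Qed.

Lemma shift_diff_inv a u : shift_diff a u^-1 = (shift_diff a u)^-1.
Proof.
apply: (mulgI (shift_diff a u)).
by rewrite -shift_diff_mul !mulgV shift_diff_one.
Qed.

Lemma shift_diff1 u : shift_diff 1 u = 1.
Proof. by rewrite /shift_diff shift1 mulgV. Qed.

Lemma shift_diffM a b u :
  shift_diff (a * b) u = shift_diff a (shift b u) * shift_diff b u.
Proof. by rewrite /shift_diff shiftM !mulgA divgK. Qed.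

Lemma shift_diffV a u : shift_diff a^-1 u = (shift_diff a (shift a^-1 u))^-1.
Proof. by rewrite /shift_diff -shiftM mulgV shift1 invgM invgK. Qed.

(* Additively, the ideal of Z[Gamma] generated by the a - 1 for a in s. *)
Fixpoint aug_ideal s : set ZG :=
  if s is a :: s' then [set shift_diff a v * w | v in setT & w in aug_ideal s']
  else [set 1].

Lemma aug_ideal_group s : subgroup (aug_ideal s).
Proof.
elim: s => [|a s [I1 IM IV]] /=.
  by split=> [//|x y -> ->|x ->]; rewrite ?mulg1 ?invg1.
split=> [|_ _ [v _ [w Iw <-]] [v' _ [w' Iw' <-]]|_ [v _ [w Iw <-]]].
- by exists 1 => //; exists 1 => //; rewrite shift_diff_one mulg1.
- exists (v * v') => //; exists (w * w'); first exact: IM.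
  by rewrite shift_diff_mul dsumACA.
- exists v^-1 => //; exists w^-1; first exact: IV.
  by rewrite shift_diff_inv (invgM (shift_diff a v)) [LHS]dsumC.
Qed.

(** By ab - 1 = (a - 1) b + (b - 1) and a^-1 - 1 = -(a - 1) a^-1, the elements whose differences all
    lie in the ideal form a subgroup, and it contains [s]. *)
Lemma aug_ideal_diff s a v :
  generated [set` s] a -> aug_ideal s (shift_diff a v).
Proof.
move=> sa; have [I1 IM IV] := aug_ideal_group s.
suff: generated [set` s] `<=` [set a | forall v, aug_ideal s (shift_diff a v)].
  by move=> /(_ a sa) /(_ v).
apply: generated_sub => [|{sa}a /= sa {}v].
  split=> [w|b c Ib Ic w|b Ib w].
  - by rewrite shift_diff1.
  - by rewrite shift_diffM; apply: IM.
  - by rewrite shift_diffV; apply: IV.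
elim: s sa {I1 IM IV} => // b s IHs; rewrite inE => /predU1P[<-|/IHs Is].
  by exists v => //; exists 1; rewrite ?mulg1 //; case: (aug_ideal_group s).
by exists 1 => //; exists (shift_diff a v); rewrite // shift_diff_one mul1g.
Qed.

(** Hence the ideal depends only on the subgroup generated by [s], and a shorter generating sequence
    may replace [s]. *)
Lemma aug_ideal_mono s t : [set` s] `<=` generated [set` t] ->
  aug_ideal s `<=` aug_ideal t.
Proof.
have [I1 IM _] := aug_ideal_group t.
elim: s => [|a s IHs] st u /=; first by move=> ->.
move=> [v _ [w sw <-]]; apply: IM.
  apply: aug_ideal_diff; apply: st; exact: mem_head.
by apply: IHs => // b sb; apply: st; rewrite /= inE sb orbT.
Qed.

(** The augmentation of the part of [u] supported on [K]. *)
Definition coef_sum K u : int :=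
  (\sum_(k <- finsupp u) if `[< K k >] then (u k : int) else 0)%R.

Lemma coef_sumE K u (F : {fset Gamma}) : (finsupp u `<=` F)%fset ->
  coef_sum K u = (\sum_(k <- F) if `[< K k >] then (u k : int) else 0)%R.
Proof.
move=> uF; apply: big_fset_incl => // k kF /fsfun_dflt ->.
by case: ifP.
Qed.

Lemma coef_sumM K u v : coef_sum K (u * v) = (coef_sum K u + coef_sum K v)%R.
Proof.
pose F := (finsupp u `|` finsupp v `|` finsupp (u * v))%fset.
rewrite !(@coef_sumE K _ F) -?big_split //=.
- apply: eq_bigr => k _; case: ifP => _; last by rewrite addr0.
  exact: (dsumME u v).
- by apply/fsubsetP => k kv; rewrite !inE kv orbT.
- by apply/fsubsetP => k ku; rewrite !inE ku.
- by apply/fsubsetP => k ku; rewrite !inE ku !orbT.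
Qed.

Lemma coef_sum1 K : coef_sum K 1 = 0%R.
Proof. by apply: (@addrI _ (coef_sum K 1)); rewrite -coef_sumM mulg1 addr0. Qed.

Lemma coef_sumV K u : coef_sum K u^-1 = (- coef_sum K u)%R.
Proof.
by apply: (@addrI _ (coef_sum K u)); rewrite -coef_sumM mulgV coef_sum1 subrr.
Qed.

(** Translation by an element of the subgroup [K] permutes [K] and preserves its complement. *)
Lemma coef_sum_shift K a u : subgroup K -> K a ->
  coef_sum K (shift a u) = coef_sum K u.
Proof.
move=> [K1 KM KV] Ka.
rewrite (@coef_sumE _ _ [fset a * k | k in finsupp u]%fset).
  rewrite big_imfset /=; last by move=> x y _ _; apply: mulgI.
  apply: eq_bigr => k _; rewrite shiftE mulKg.
  suff -> : `[< K (a * k) >] = `[< K k >] by [].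
  apply: asbool_equiv_eq; split=> [Kak|]; last exact: KM.
  by rewrite -[k](mulKg a); apply: KM => //; apply: KV.
apply/fsubsetP => k; rewrite mem_finsupp shiftE => uk.
apply/imfsetP; exists (a^-1 * k); rewrite ?mulVKg //=.
by rewrite mem_finsupp.
Qed.

(** In each term [shift_diff a v], translation by [a] in [K] does not change the sum, so the two
    halves cancel. *)
Lemma coef_sum_aug_ideal K s u : subgroup K -> [set` s] `<=` K ->
  aug_ideal s u -> coef_sum K u = 0%R.
Proof.
move=> Kgrp; elim: s u => [|a s IHs] u sK /=.
  by move=> ->; apply: coef_sum1.
move=> [v _ [w sw <-]]; rewrite 2!coef_sumM coef_sumV coef_sum_shift //.
  rewrite subrr add0r; apply: IHs => // b sb.
  by apply: sK; rewrite /= inE sb orbT.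
by apply: sK; apply: mem_head.
Qed.

(** The unit of the ring Z[Gamma], whereas [1 : ZG] is its zero; [shift a dirac] is the basis
    element a. *)
Definition dirac : ZG := [fsfun k in [fset 1 : Gamma]%fset => (1%Z : Z) | 1].

Lemma diracE k : (dirac k : int) = (k == 1%g)%:R%R.
Proof. by rewrite fsfunE inE; case: eqP. Qed.

Lemma coef_sum_shift_dirac K a : coef_sum K (shift a dirac) = `[< K a >]%:R%R.
Proof.
rewrite (@coef_sumE _ _ [fset a]%fset).
  by rewrite big_seq_fset1 shiftE mulVg diracE eqxx; case: asboolP.
apply/fsubsetP => k; rewrite mem_finsupp shiftE inE; apply: contraNT => ka.
apply/eqP; rewrite [LHS]diracE; case: eqP => // ak1.
by rewrite -[k](mulVKg a) ak1 mulg1 eqxx in ka.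
Qed.

(* The element [\sum_(a <- s) (a - 1)]. *)
Definition aug_sum s : ZG := \prod_(a <- s) shift_diff a dirac.

Lemma aug_sum_mem s : aug_ideal s (aug_sum s).
Proof.
rewrite /aug_sum; elim: s => [|a s IHs]; first by rewrite big_nil.
rewrite big_cons; exists dirac => //.
by exists (\prod_(b <- s) shift_diff b dirac).
Qed.

Lemma coef_sum_aug_sum K s : K 1 ->
  coef_sum K (aug_sum s) = (\sum_(a <- s) (`[< K a >]%:R - 1))%R.
Proof.
move=> K1; rewrite /aug_sum; elim: s => [|a s IHs].
  by rewrite !big_nil coef_sum1.
rewrite !big_cons 2!coef_sumM IHs coef_sumV coef_sum_shift_dirac.
by rewrite -[dirac]shift1 coef_sum_shift_dirac (asboolT K1).
Qed.

(* Since [1] lies in the subgroup [K] generated by [t], the coefficients of the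
   sum of the [a - 1] over [K] add up to minus the number of [a] outside [K]. *)
Lemma aug_sum_ideal s t :
  aug_ideal t (aug_sum s) -> [set` s] `<=` generated [set` t].
Proof.
have Kgrp := generated_group [set` t]; have [K1 _ _] := Kgrp.
move=> /(coef_sum_aug_ideal Kgrp (@mem_generated _ _)).
(* After the sign change every summand is 0 or 1, so a zero sum makes all of them vanish. *)
rewrite coef_sum_aug_sum // => /eqP; rewrite -oppr_eq0 -sumrN psumr_eq0.
  by move=> /allP s0 a /s0; case: asboolP.
by move=> a _; case: asboolP.
Qed.

End AugmentationIdeals.

(** * Products of mixed commutators and their least length *)

Section CommutatorLength.
Local Open Scope group_scope.
Variables (G : groupType) (N : set G).

Lemma mixed_commutator_product0 x : mixed_commutator_product N 0 x <-> x = 1.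
Proof.
split=> [[c _ ->]|->]; first by rewrite big_ord0.
by exists (fun=> 1) => [[]|]; rewrite // big_ord0.
Qed.

Lemma mixed_commutator_productS n x : mixed_commutator_product N n.+1 x <->
  exists c y,
    [/\ mixed_commutators N c, mixed_commutator_product N n y & x = c * y].
Proof.
split=> [[c Nc ->]|[c [_ [Nc [c' Nc' ->] ->]]]].
  rewrite big_ord_recl; exists (c ord0), (\prod_(i < n) c (lift ord0 i)).
  by split=> //; exists (fun i => c (lift ord0 i)).
exists (fun i => if unlift ord0 i is Some j then c' j else c) => [i|].
  by case: unliftP.
rewrite big_ord_recl unlift_none; congr (_ * _).
by apply: eq_bigr => i _; rewrite liftK.
Qed.

(** A minimum is unique, so [xget] returns it; the default is excluded because [n] itself
    qualifies. *)
Lemma cl_eq n x : mixed_commutator_product N n x ->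
  (forall m, mixed_commutator_product N m x -> (n <= m)%N) -> cl N x = n.
Proof.
move=> Nn n_min; rewrite /cl; case: xgetP => [m _ [Nm m_min]|/(_ n)[]//].
by apply/eqP; rewrite eqn_leq m_min //= n_min.
Qed.

End CommutatorLength.

(** * Commutators of the wreath product in terms of augmentation ideals *)

Section WreathCommutators.
Local Open Scope group_scope.
Local Notation Z := (Algebra.to_multiplicative int).
Variable Gamma : groupType.
Hypothesis cGamma : forall a b : Gamma, commute a b.
Local Notation G := (wreath Z Gamma).
Local Notation N := (base_group Z Gamma).
Implicit Types (u v w : dsum Gamma Z) (a b : Gamma) (s t : seq Gamma) (x : G).

Lemma base_injM u v : base_inj (u * v) = base_inj u * base_inj v.
Proof. by congr Wreath; rewrite /= ?shift1 ?mulg1. Qed.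

Lemma base_inj_inj : injective (@base_inj Z Gamma).
Proof. by move=> u v []. Qed.

(** As [Gamma] is abelian, the top component cancels and the shifts recombine into (a - 1) v - (b -
    1) u. *)
Lemma wreath_commutator u v a b : commutator (Wreath u a : G) (Wreath v b) =
  base_inj (shift_diff a v * shift_diff b u^-1).
Proof.
rewrite /commutator; congr Wreath; rewrite /=; last first.
  by rewrite (cGamma a b) mulgK mulgV.
rewrite -!shiftM /shift_diff (cGamma a b) mulgK mulgV shift1 invgK.
by rewrite (dsumC u) -[LHS]mulgA [X in _ * X = _]dsumC dsumACA (dsumC u).
Qed.

Lemma mixed_commutatorsP x :
  mixed_commutators N x <-> exists a v, x = base_inj (shift_diff a v).
Proof.
split=> [[[u a] _ [_ [v _ <-] <-]]|[a [v ->]]].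
  by exists a, v; rewrite wreath_commutator shift_diff1 mulg1.
exists (Wreath 1 a) => //; exists (base_inj v); first by exists v.
by rewrite wreath_commutator shift_diff1 mulg1.
Qed.

Lemma commutatorsP x : mixed_commutators [set: G] x <->
  exists a v b u, x = base_inj (shift_diff a v * shift_diff b u).
Proof.
split=> [[[u a] _ [[v b] _ <-]]|[a [v [b [u ->]]]]].
  by exists a, v, b, u^-1; rewrite wreath_commutator.
exists (Wreath u^-1 a) => //; exists (Wreath v b) => //.
by rewrite wreath_commutator invgK.
Qed.

Definition in_aug_ideal n u := exists2 s, size s = n & aug_ideal s u.

Lemma mixed_commutator_productP n x :
  mixed_commutator_product N n x <->
  exists2 u, in_aug_ideal n u & x = base_inj u.
Proof.
elim: n x => [|n IHn] x.
  rewrite mixed_commutator_product0; split=> [->|[u [[|//] _ ->] ->]] //.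
  by exists 1 => //; exists [::].
rewrite mixed_commutator_productS; split.
  move=> [_ [_ [/mixed_commutatorsP[a [v ->]] /IHn[w [s <- sw] ->] ->]]].
  exists (shift_diff a v * w); last by rewrite base_injM.
  by exists (a :: s) => //; exists v => //; exists w.
move=> [_ [[//|a s] [sn] [v _ [w sw <-]]] ->].
exists (base_inj (shift_diff a v)), (base_inj w); split; last exact: base_injM.
  by apply/mixed_commutatorsP; exists a, v.
by apply/IHn; exists w => //; exists s.
Qed.

(** One commutator supplies two arbitrary terms [shift_diff], hence the doubling. *)
Lemma commutator_productP n x : mixed_commutator_product [set: G] n x <->
  exists2 u, in_aug_ideal n.*2 u & x = base_inj u.
Proof.
elim: n x => [|n IHn] x.
  rewrite mixed_commutator_product0; split=> [->|[u [[|//] _ ->] ->]] //.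
  by exists 1 => //; exists [::].
rewrite mixed_commutator_productS doubleS; split.
  move=> [_ [_ [/commutatorsP[a [v [b [u ->]]]] /IHn[w [s <- sw] ->] ->]]].
  exists (shift_diff a v * (shift_diff b u * w)); last first.
    by rewrite -base_injM -(mulgA (shift_diff a v)).
  exists [:: a, b & s] => //; exists v => //; exists (shift_diff b u * w) => //.
  by exists u => //; exists w.
move=> [_ [[//|a [//|b s]] [sn] [v _ [_ [u _ [w sw <-]] <-]]] ->].
exists (base_inj (shift_diff a v * shift_diff b u)), (base_inj w).
split; last by rewrite -base_injM -(mulgA (shift_diff a v)).
  by apply/commutatorsP; exists a, v, b, u.
by apply/IHn; exists w => //; exists s.
Qed.

(** A sequence can be padded with [1], whose difference is trivial. *)
Lemma in_aug_ideal_mono m n u : (m <= n)%N ->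
  in_aug_ideal m u -> in_aug_ideal n u.
Proof.
move=> /subnK <- [s <- su]; elim: (n - size s)%N => [|k [t ts tu]].
  by exists s.
exists (1 :: t); first by rewrite /= ts.
by exists 1 => //; exists u => //; rewrite shift_diff1 mul1g.
Qed.

Definition aug_length n u :=
  in_aug_ideal n u /\ forall m, in_aug_ideal m u -> (n <= m)%N.

(** Length m in the whole group means 2m terms, and n <= 2m exactly when [uphalf n], the ceiling of
    n/2, is at most m. *)
Lemma cl_base n u : aug_length n u ->
  cl N (base_inj u : G) = n /\ cl [set: G] (base_inj u : G) = uphalf n.
Proof.
move=> [nu n_min]; split; apply: cl_eq.
- by apply/mixed_commutator_productP; exists u.
- move=> m /mixed_commutator_productP[w mw /base_inj_inj uw].
  by apply: n_min; rewrite uw.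
- apply/commutator_productP; exists u => //; apply: in_aug_ideal_mono nu.
  by rewrite -leq_uphalf_double.
- move=> m /commutator_productP[w mw /base_inj_inj uw].
  by rewrite leq_uphalf_double; apply: n_min; rewrite uw.
Qed.

(** The ideals of [s] and [t] both lie in that of [s ++ t], so their union is a subgroup; a least
    length then exists for each of its elements. *)
Lemma mixed_commutator_subgroupP x : mixed_commutator_subgroup N x <->
  exists n u, aug_length n u /\ x = base_inj u.
Proof.
have [I1 IM IV] := generated_group (mixed_commutators N).
split=> [Nx|[n [u [[[s _ su] _] ->]]]].
  suff [s [u su ->]] : exists s, exists2 u, aug_ideal s u & x = base_inj u.
    have ex_n : exists n, `[< in_aug_ideal n u >].
      by exists (size s); apply/asboolP; exists s.
    have [n /asboolP nu n_min] := ex_minnP ex_n; exists n, u; split=> //.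
    by split=> // m mu; apply/n_min/asboolP.
  suff: generated (mixed_commutators N) `<=`
      [set x | exists s, exists2 u, aug_ideal s u & x = base_inj u] by apply.
  apply: generated_sub => [|y /mixed_commutatorsP[a [v ->]]]; last first.
    exists [:: a], (shift_diff a v) => //.
    by apply: aug_ideal_diff; apply: mem_generated; apply: mem_head.
  split=> [|y z [s [u su ->]] [t [v tv ->]]|y [s [u su ->]]].
  - by exists [::], 1.
  - exists (s ++ t), (u * v); last by rewrite base_injM.
    have [_ IstM _] := aug_ideal_group (s ++ t); apply: IstM.
      apply: aug_ideal_mono su => a sa; apply: mem_generated.
      by rewrite /= mem_cat sa.
    apply: aug_ideal_mono tv => a ta; apply: mem_generated.
    by rewrite /= mem_cat ta orbT.
  - exists s, u^-1; first by have [_ _] := aug_ideal_group s; apply.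
    by apply: (mulgI (base_inj u)); rewrite mulgV -base_injM mulgV.
elim: s u su => [|a s IHs] u /=; first by move->; apply: I1.
move=> [v _ [w sw <-]]; rewrite base_injM; apply: IM; last exact: IHs.
by apply: mem_generated; apply/mixed_commutatorsP; exists a, v.
Qed.

(** If a shorter [t] generated a subgroup containing [s], its ideal would contain [u], against
    minimality. *)
Lemma aug_length_independent n u : aug_length n u ->
  exists2 s : seq Gamma, size s = n & independent s.
Proof.
move=> [[s sn su] n_min]; exists s => // t st; rewrite sn.
by apply: n_min; exists t => //; apply: aug_ideal_mono su.
Qed.

Lemma aug_sum_length s : independent s -> aug_length (size s) (aug_sum s).
Proof.
move=> ind_s; split=> [|m [t <- /aug_sum_ideal]]; last exact: ind_s.
by exists s => //; apply: aug_sum_mem.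
Qed.

End WreathCommutators.

Local Open Scope ring_scope.

(** * Special rank and independent sequences *)

Section SpecialRank.
Variables (R : realType) (Gamma : groupType).

Lemma rk_le_size (s : seq Gamma) :
  (rk R (generated [set` s]) <= (size s)%:R%:E)%E.
Proof.
(* [rk] counts the elements of finite sets, while [s] may have repetitions. *)
apply: (@le_trans _ _ (size (undup s))%:R%:E); last first.
  by rewrite lee_fin ler_nat size_undup.
apply: ereal_inf_lbound; exists [fset x in s]%fset; last by rewrite card_fseq.
by congr generated; apply/seteqP; split=> x /=; rewrite inE.
Qed.

Lemma spe_rk_ge r (K : set Gamma) : fin_gen K ->
  (forall s, K = generated [set` s] -> (r <= size s)%N) ->
  ((r%:R)%:E <= spe_rk Gamma R)%E.
Proof.
move=> Kfin rK; apply: le_ereal_sup_tmp; exists (rk R K); first by exists K.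
apply/ereal_infP => _ [S KS <-]; rewrite lee_fin ler_nat.
exact: rK KS.
Qed.

Hypothesis cGamma : forall a b : Gamma, commute a b.

(** From a finitely generated subgroup of rank at least [r], a shortest generating sequence is cut
    to its first [r] entries, which are independent because no shorter sequence can replace them. *)
Lemma spe_rk_geP r : ((r%:R)%:E <= spe_rk Gamma R)%E <->
  exists2 s : seq Gamma, size s = r & independent s.
Proof.
split=> [|[s <- ind_s]]; last first.
  apply: (@spe_rk_ge _ (generated [set` s])); first by apply/fin_genP; exists s.
  move=> t st; apply: ind_s; rewrite -st.
  exact: mem_generated.
(* The supremum need not be attained, so a subgroup is extracted from a strict bound by the
   predecessor; this needs [r] positive. *)
case: r => [_|r r_le]; first by exists [::].
have [K Kfin rK] : exists2 K : set Gamma, fin_gen K & (r%:R%:E < rk R K)%E.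
  have: (r%:R%:E < spe_rk Gamma R)%E.
    by apply: lt_le_trans r_le; rewrite lte_fin ltr_nat.
  by move=> /ereal_sup_gt[_ [K Kfin <-] rK]; exists K.
have {rK} K_gt s : K = generated [set` s] -> (r < size s)%N.
  move=> Ks; rewrite -(ltr_nat R) -lte_fin.
  by apply: lt_le_trans rK _; rewrite Ks rk_le_size.
have ex_n : exists n, `[< exists2 s, size s = n & K = generated [set` s] >].
  have [s Ks] := (fin_genP K).1 Kfin.
  by exists (size s); apply/asboolP; exists s.
have [n /asboolP[s sn Ks] n_min] := ex_minnP ex_n; have rs := K_gt s Ks.
exists (take r.+1 s); first by rewrite size_takel.
move=> t /(generated_sub (generated_group _)) st; rewrite size_takel //.
(* Monotonicity of the rank turns containment into equality: [t'] generates the same subgroup as the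
   first entries of [s], so it can replace them, and minimality of [n] bounds its size from
   below. *)
have [t' t't et'] := subgroup_generated cGamma (generated_group _) st.
apply: leq_trans _ t't; rewrite -(leq_add2r (size (drop r.+1 s))).
rewrite -(size_cat t') size_drop subnKC // sn; apply: n_min.
apply/asboolP; exists (t' ++ drop r.+1 s); first by [].
rewrite Ks; apply: eq_generated => a /=; last first.
  rewrite mem_cat => /orP[at'|/mem_drop sa]; last exact: mem_generated.
  apply: (@generated_take _ (r.+1)); rewrite et'; exact: mem_generated.
rewrite -{1}(cat_take_drop r.+1 s) mem_cat => /orP[sa|sa]; last first.
  by apply: mem_generated; rewrite /= mem_cat sa orbT.
have: generated [set` t'] a by rewrite -et'; apply: mem_generated.
apply: generated_sub => [|b tb]; first exact: generated_group.
by apply: mem_generated; rewrite /= mem_cat; apply/orP; left.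
Qed.

(** A non-cyclic finitely generated subgroup has no generating sequence with 0 or 1 entries; the
    empty one gives the trivial subgroup, generated by [1]. *)
Lemma spe_rk_ge2 : ~ locally_cyclic Gamma -> (2%:R%:E <= spe_rk Gamma R)%E.
Proof.
move=> nlc; apply: contrapT => spe_lt2; apply: nlc => K Kfin.
apply: contrapT => ncyc; apply: spe_lt2.
apply: (spe_rk_ge Kfin) => -[|a [|//]] Ks.
  case: ncyc; exists 1%g; rewrite Ks.
  have [g1 _ _] := generated_group [set 1%g : Gamma].
  apply/seteqP; split; apply: generated_sub => //; try exact: generated_group.
  by move=> _ ->; case: (generated_group [set` ([::] : seq Gamma)]).
case: ncyc; exists a; rewrite Ks; congr generated.
by apply/seteqP; split=> x /=; rewrite inE => /eqP.
Qed.

Lemma ceil_half r : Num.ceil (r%:R / 2 : R) = (uphalf r)%:Z.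
Proof.
apply: ceil_def.
rewrite -[in r%:R](odd_double_half r) uphalf_half natrD -muln2 natrM.
by case: (odd r); rewrite /= ?add0n ?add1n; apply/andP; split; lra.
Qed.

End SpecialRank.

(** * The pairs of lengths and the comparison of the two functions *)

Theorem theorem1p8 (R : realType) (Gamma : groupType)
    (abelian_Gamma : forall a b : Gamma, commute a b) :
  let Z : groupType := Algebra.to_multiplicative int in
  let G := wreath Z Gamma in
  let N : set G := base_group Z Gamma in
  let GN : set G := mixed_commutator_subgroup N in
  let cl_G : G -> nat := cl [set: G] in
  let cl_GN : G -> nat := cl N in
  [/\ [set ((cl_G x)%:Z, cl_GN x) | x in GN] =
        [set (Num.ceil (r%:R / 2 : R), r) |
           r in [set r : nat | ((r%:R)%:E <= spe_rk Gamma R)%E]],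
      split_exact N (@wtop Z Gamma),
      (~ locally_cyclic Gamma -> ~ (forall x, GN x -> cl_G x = cl_GN x))
    & (spe_rk Gamma R = +oo%E ->
       forall C : R, C < 2 ->
         ereal_sup [set ((cl_GN x)%:R - C * (cl_G x)%:R)%:E | x in GN]
           = +oo%E)].
Proof.
move=> Z G N GN cl_G cl_GN.
(* Every admissible [r] is attained by the sum of the a - 1 over an independent sequence of length
   [r]. *)
have realize r : ((r%:R)%:E <= spe_rk Gamma R)%E ->
    exists2 x, GN x & cl_G x = uphalf r /\ cl_GN x = r.
  move=> /(spe_rk_geP R abelian_Gamma)[s <- /aug_sum_length s_len].
  exists (base_inj (aug_sum s)).
    apply/(mixed_commutator_subgroupP abelian_Gamma).
    by exists (size s), (aug_sum s).
  have [clN clG] := cl_base abelian_Gamma s_len.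
  by rewrite /cl_G /cl_GN clN clG.
split.
- apply/seteqP; split=> [_ [x GNx <-]|_ [r r_le <-]].
    have [n [u [u_len xu]]] :=
      (mixed_commutator_subgroupP abelian_Gamma x).1 GNx.
    have [clN clG] := cl_base abelian_Gamma u_len.
    exists n; last by rewrite ceil_half /cl_G /cl_GN xu clN clG.
    by apply/(spe_rk_geP R abelian_Gamma); apply: aug_length_independent u_len.
  have [x GNx [clG clN]] := realize r r_le.
  by exists x; rewrite // clG clN ceil_half.
- split=> [//||].
    apply/seteqP; split=> [[u a] /= ->|_ [u _ <-] //].
    by exists u.
  exists (fun a => Wreath 1%g a : G) => //; split=> // a b.
  by congr Wreath; rewrite /= shift_one mulg1.
(* At r = 2 the two lengths are 1 and 2. *)
- move=> /(spe_rk_ge2 R)/realize[x GNx [clG clN]] /(_ x GNx).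
  by rewrite clG clN.
- move=> spe_oo C C_lt2; apply/eqyP => A A_gt0.
  have C2_gt0 : 0 < 2 - C by rewrite subr_gt0.
  (* An element with lengths k and 2k gives the value k (2 - C), and [k] is chosen to make it at
     least [A]. *)
  pose k := Num.bound (A / (2 - C)).
  have A_le : A <= k%:R * (2 - C).
    by rewrite -ler_pdivrMr // ltW // archi_boundP // divr_ge0 // ltW.
  have [|x GNx [clG clN]] := realize k.*2; first by rewrite spe_oo leey.
  apply: le_ereal_sup_tmp; exists ((cl_GN x)%:R - C * (cl_G x)%:R)%:E.
    by exists x.
  rewrite clG clN uphalf_double lee_fin (le_trans A_le) // -muln2 natrM.
  by rewrite mulrBr (mulrC C).
Qed.
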